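(* The border support rank of $\langle 2,2,2\rangle$ over $\mathbb{C}$ is $7$. That is, every tensor $t\in \mathbb{C}^{2\times 2}\otimes\mathbb{C}^{2\times 2}\otimes\mathbb{C}^{2\times 2}$ with the same support as $\langle 2,2,2\rangle$ has border rank at least $7$, and some such tensor has border rank exactly $7$.
   Context: Let $e_{ij}$ ($i,j\in\{1,2\}$) be the standard basis of $\mathbb{C}^{2\times 2}$ and $\langle 2,2,2\rangle=\sum_{i,j,k\in\{1,2\}} e_{ij}\otimes e_{jk}\otimes e_{ki}$. The support of a tensor (with respect to the basis $\{e_{ab}\otimes e_{cd}\otimes e_{ef}\}$) is the set of basis elements with nonzero coefficient. The border rank of a tensor $t\in V_1\otimes V_2\otimes V_3$ over $\mathbb{C}$ is the smallest $r$ such that $t$ lies in the Zariski closure of the set of tensors of tensor rank at most $r$. The border support rank of $t$ is the minimal border rank of a complex tensor with the same support as $t$. *)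

(* Defs.v *)
From HB Require Import structures.
From mathcomp Require Import all_boot all_order all_algebra.
Set Implicit Arguments. Unset Strict Implicit. Unset Printing Implicit Defensive.
Import GRing.Theory.
Local Open Scope ring_scope.

(* Index of the standard basis e_ab of K^{2x2}: the pair (a,b). *)
Definition idx := ('I_2 * 'I_2)%type.

(* Tensors in K^{2x2} (x) K^{2x2} (x) K^{2x2}: coefficient functions
   w.r.t. the basis e_ab (x) e_cd (x) e_ef. *)
Definition tensor (K : Type) := idx -> idx -> idx -> K.

(* Matrix multiplication tensor <2,2,2> = sum_{i,j,k} e_ij (x) e_jk (x) e_ki. *)
Definition mamu (K : nzRingType) : tensor K :=
  fun x y z => if [&& x.2 == y.1, y.2 == z.1 & z.2 == x.1] then 1 else 0.

Definition same_support (K : nzRingType) (s t : tensor K) : Prop :=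
  forall x y z, (s x y z != 0) = (t x y z != 0).

Definition rank_le (K : nzRingType) (t : tensor K) (r : nat) : Prop :=
  exists (u v w : 'I_r -> idx -> K),
    forall x y z, t x y z = \sum_(l < r) u l x * v l y * w l z.

Inductive tpoly (K : Type) : Type :=
| PVar of idx & idx & idx
| PConst of K
| PAdd of tpoly K & tpoly K
| PMul of tpoly K & tpoly K.

Fixpoint peval (K : nzRingType) (p : tpoly K) (t : tensor K) : K :=
  match p with
  | PVar x y z => t x y z
  | PConst c => c
  | PAdd p q => peval p t + peval q t
  | PMul p q => peval p t * peval q t
  end.

Definition in_zariski_closure (K : nzRingType) (S : tensor K -> Prop)
  (t : tensor K) : Prop :=
  forall p : tpoly K, (forall s, S s -> peval p s = 0) -> peval p t = 0.

Definition border_rank_le (K : nzRingType) (t : tensor K) (r : nat) : Prop :=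
  in_zariski_closure (fun s => rank_le s r) t.

(* Main.v *)
(* Lower bound, by border apolarity.  A tensor t of border rank at most 6 is the image of a
   generic rank 6 tensor sum_l u_l v_l w_l under a partially defined ring homomorphism F -> K,
   where F is the field of rational functions in the entries of u, v, w.  By extending this
   homomorphism, the 6-dimensional spans of the u_l v_l, of the u_l u_l v_l and of the u_l v_l v_l
   acquire 6-dimensional limits over K: a space E of matrices containing the slices of t, and
   spaces of tensors that are symmetric in their first (resp. last) two factors, with slices
   in E.  If t has the support of <2,2,2>, its slices span a 4-dimensional space whose quotient
   in A (x) B is U (x) C^3 (x) W with dim U = dim W = 2, and E becomes a plane there.  The first
   symmetric space being 6-dimensional forces this plane to be essentially U (x) s (x) w, the
   second one forces it to be u (x) s (x) W, and these are incompatible.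
   The upper bound is Strassen's algorithm. *)
Require Import Defs.
From HB Require Import structures.
From mathcomp Require Import all_boot all_order all_algebra.
From mathcomp Require Import ring zify mpoly.
From Stdlib Require Import Classical.
Set Implicit Arguments. Unset Strict Implicit. Unset Printing Implicit Defensive.
Import GRing.Theory.
Local Open Scope ring_scope.

(** * Extension of specializations *)

(* [G] is the graph of a surjective homomorphism from a subring of [F] to [K]. *)
Record specialization (F K : fieldType) (G : F -> K -> Prop) : Prop := Specialization {
  spec1 : G 1 1;
  specN : forall a b, G a b -> G (- a) (- b);
  specD : forall a b a' b', G a b -> G a' b' -> G (a + a') (b + b');
  specM : forall a b a' b', G a b -> G a' b' -> G (a * a') (b * b');
  spec0E : forall b, G 0 b -> b = 0;
  spec_onto : forall b, exists a, G a b }.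

(** By Euclidean division a nonzero element of least degree in the ideal [J] divides all others. It
    is a constant, or it has a root since [K] is algebraically closed. *)
Lemma ideal_root (K : closedFieldType) (J : {poly K} -> Prop) :
    (forall p q, J p -> J q -> J (p - q)) -> (forall r p, J p -> J (r * p)) ->
  J 1 \/ exists c, forall p, J p -> root p c.
Proof.
move=> JB JM.
have [[g Jg g0]|noJ] := classic (exists2 g, J g & g != 0); last first.
  right; exists 0 => p Jp; have [->|p0] := eqVneq p 0; first exact: root0.
  by case: noJ; exists p.
have [n le_g_n] := ubnP (size g).
elim: n => // n IHn in g Jg g0 le_g_n *.
have [[h Jh ndvd]|dvdJ] := classic (exists2 h, J h & h %% g != 0).
  apply: (IHn (h %% g)) => //; last first.
    by rewrite (leq_trans _ (le_g_n : size g <= n)%N) // ltn_modp.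
  have ->: h %% g = h - (h %/ g) * g by rewrite {2}(divp_eq h g) addrC addKr.
  by apply: JB => //; apply: JM.
have [s1|sg1] := eqVneq (size g) 1.
  left; move/eqP/size_poly1P: s1 => [c c0 gE].
  have ->: 1 = c^-1%:P * g by rewrite gE -polyCM mulVf.
  exact: JM.
right; have /closed_rootP[c rc] := sg1.
exists c => p Jp; have /eqP pg0: p %% g == 0.
  by apply/negPn/negP => pg; apply: dvdJ; exists p.
by rewrite (divp_eq p g) pg0 addr0 rootM rc orbT.
Qed.

Section Extension.

Variables (F : fieldType) (K : closedFieldType) (G : F -> K -> Prop).
Hypothesis specG : specialization G.

Lemma spec0 : G 0 0.
Proof. by have := specD specG (spec1 specG) (specN specG (spec1 specG)); rewrite !subrr. Qed.

Lemma spec_sum (I : Type) (r : seq I) (a : I -> F) (b : I -> K) :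
  (forall i, G (a i) (b i)) -> G (\sum_(i <- r) a i) (\sum_(i <- r) b i).
Proof.
move=> Gab; apply: big_ind2 => [|a1 b1 a2 b2|//]; first exact: spec0.
exact: (specD specG).
Qed.

Lemma spec_inj a b b' : G a b -> G a b' -> b = b'.
Proof.
move=> Gb /(specN specG) /(specD specG Gb); rewrite subrr => /(spec0E specG) /eqP.
by rewrite subr_eq0 => /eqP.
Qed.

Definition poly_spec (P : {poly F}) (Q : {poly K}) := forall i, G P`_i Q`_i.

(** Candidate extension of the specialization sending [x] to [c]. It is only a relation, as [a] may
    be the value at [x] of several polynomials. *)
Definition adjoin (x : F) (c : K) (a : F) (b : K) :=
  exists P Q, [/\ poly_spec P Q, a = P.[x] & b = Q.[c]].

Lemma poly_specC a b : G a b -> poly_spec a%:P b%:P.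
Proof. by move=> Gab i; rewrite !coefC; case: eqP => // _; apply: spec0. Qed.

Lemma poly_specN P Q : poly_spec P Q -> poly_spec (- P) (- Q).
Proof. by move=> PQ i; rewrite !coefN; apply: (specN specG). Qed.

Lemma poly_specD P Q P' Q' :
  poly_spec P Q -> poly_spec P' Q' -> poly_spec (P + P') (Q + Q').
Proof. by move=> PQ PQ' i; rewrite !coefD; apply: (specD specG). Qed.

Lemma poly_specM P Q P' Q' :
  poly_spec P Q -> poly_spec P' Q' -> poly_spec (P * P') (Q * Q').
Proof.
move=> PQ PQ' i; rewrite !coefM.
by apply: spec_sum => j; apply: (specM specG).
Qed.

Lemma adjoin_sub x c a b : G a b -> adjoin x c a b.
Proof.
by move=> Gab; exists a%:P, b%:P; split; [exact: poly_specC | rewrite hornerC ..].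
Qed.

Lemma adjoin_gen x c : adjoin x c x c.
Proof.
exists 'X, 'X; split; rewrite ?hornerX // => i; rewrite !coefX.
by case: eqP => _; [exact: spec1 specG | exact: spec0].
Qed.

Lemma adjoin_specialization x c :
    (forall P Q, poly_spec P Q -> P.[x] = 0 -> root Q c) ->
  specialization (adjoin x c).
Proof.
move=> rootQ; split.
- exact: adjoin_sub (spec1 specG).
- move=> _ _ [P [Q [PQ -> ->]]]; exists (- P), (- Q).
  by rewrite !hornerN; split=> //; apply: poly_specN.
- move=> _ _ _ _ [P [Q [PQ -> ->]]] [P' [Q' [PQ' -> ->]]].
  by exists (P + P'), (Q + Q'); rewrite !hornerD; split=> //; apply: poly_specD.
- move=> _ _ _ _ [P [Q [PQ -> ->]]] [P' [Q' [PQ' -> ->]]].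
  by exists (P * P'), (Q * Q'); rewrite !hornerM; split=> //; apply: poly_specM.
- by move=> b [P [Q [PQ /esym Px0 ->]]]; apply/rootP/(rootQ P).
- move=> b; have [a Gab] := spec_onto specG b.
  by exists a; apply: adjoin_sub.
Qed.

(** The reductions of the polynomials vanishing at [x] form an ideal of [{poly K}], by surjectivity
    of the specialization. A common root is an admissible value for [x]; otherwise the ideal
    contains 1. *)
Lemma spec_extend_or x :
  (exists c, specialization (adjoin x c)) \/
  (exists2 P, poly_spec P 1 & P.[x] = 0).
Proof.
pose J Q := exists2 P, poly_spec P Q & P.[x] = 0.
have JB p q : J p -> J q -> J (p - q).
  case=> P Pp P0 [Q Qq Q0]; exists (P - Q); last by rewrite hornerD hornerN P0 Q0 subr0.
  by apply: poly_specD => //; apply: poly_specN.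
have JM r p : J p -> J (r * p).
  case=> P Pp P0.
  have [R Rr] : exists R, poly_spec R r.
    have [rho /= rhoP] := fin_all_exists (fun i : 'I_(size r) => spec_onto specG r`_i).
    exists (\poly_(i < size r) (if insub i is Some j then rho j else 0)) => i.
    rewrite coef_poly; case: ltnP => [lt_i|le_i]; last by rewrite nth_default //; apply: spec0.
    by rewrite insubT.
  by exists (R * P); [exact: poly_specM | rewrite hornerM P0 mulr0].
have [J1|[c rootc]] := ideal_root JB JM; first by right.
left; exists c; apply: adjoin_specialization => P Q PQ Px0.
by apply: rootc; exists P.
Qed.

(* If both P(x) = 0 and Q(1/x) = 0 with P, Q reducing to 1, then subtracting a multiple
   of the reversal of Q from Q(0) P cancels the leading term of the longer polynomial P. *)
Lemma spec_extend_contra (x : F) P Q : x != 0 -> poly_spec P 1 -> poly_spec Q 1 ->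
  P.[x] = 0 -> Q.[x^-1] = 0 -> False.
Proof.
have [n] := ubnP (size P + size Q).
elim: n => // n IHn in x P Q *; rewrite ltnS => le_n x0.
wlog le_QP : x P Q le_n x0 / (size Q <= size P)%N.
  move=> wl P1 Q1 Px Qx; have [le|/ltnW le] := leqP (size Q) (size P).
    exact: (wl x P Q).
  by apply: (wl x^-1 Q P); rewrite ?invr_eq0 ?invrK // addnC.
move=> P1 Q1 Px Qx.
have [m sP] : exists m, size P = m.+1.
  case sP : (size P) => [|m]; last by exists m.
  have := P1 0%N; rewrite nth_default ?sP // coef1 /= => /(spec0E specG) /eqP.
  by rewrite oner_eq0.
have m0 : (0 < m)%N.
  rewrite lt0n; apply/eqP => m0; rewrite m0 in sP.
  have /size_poly1P[a a0 PE] : size P == 1%N by rewrite sP.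
  by move: Px a0; rewrite PE hornerC => ->; rewrite eqxx.
pose a' i := Q`_0 * P`_i - P`_m * Q`_(m - i).
have sumE : \sum_(i < m.+1) a' i * x ^+ i = 0.
  have PE : \sum_(i < m.+1) P`_i * x ^+ i = 0 by rewrite -sP -horner_coef.
  have QE : \sum_(i < m.+1) Q`_(m - i) * x ^+ i = 0.
    transitivity (x ^+ m * Q.[x^-1]); last by rewrite Qx mulr0.
    rewrite (@horner_coef_wide _ m.+1) -?sP // sP.
    rewrite [in RHS](reindex_inj rev_ord_inj) mulr_sumr. apply: eq_bigr => i _ /=.
    rewrite subSS mulrCA; congr (_ * _).
    rewrite -{2}(subnK (ltn_ord i : i <= m)%N) exprD exprVn mulrC mulrA.
    by rewrite mulVf ?mul1r // expf_neq0.
  transitivity (Q`_0 * \sum_(i < m.+1) P`_i * x ^+ i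
                - P`_m * \sum_(i < m.+1) Q`_(m - i) * x ^+ i); last first.
    by rewrite PE QE !mulr0 subr0.
  by rewrite !mulr_sumr -sumrB; apply: eq_bigr => i _; rewrite /a' mulrBl !mulrA.
pose P' := \poly_(i < m) a' i.
apply: (IHn x P' Q) => //.
- apply: leq_ltn_trans (_ : m + size Q < _)%N; first by rewrite leq_add2r size_poly.
  by rewrite (leq_trans _ le_n) // sP addSn.
- move=> i; rewrite coef_poly coef1; case: ltnP => [lt_im|le_mi]; last first.
    by rewrite gtn_eqF ?(leq_trans m0) //; apply: spec0.
  (* As [m > 0], the leading coefficient of [P] reduces to 0, so the subtracted multiple does not
     affect the reduction. *)
  rewrite /a'; have -> : (i == 0%N)%:R = 1 * (i == 0%N)%:R - 0 * (m - i == 0)%N%:R :> K.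
    by rewrite mul1r mul0r subr0.
  apply: (specD specG); last apply: (specN specG).
    by apply: (specM specG); [have := Q1 0%N | have := P1 i]; rewrite coef1.
  apply: (specM specG); last by have := Q1 (m - i)%N; rewrite coef1.
  by have := P1 m; rewrite coef1 gtn_eqF.
- rewrite horner_poly; move: sumE; rewrite big_ord_recr /= {2}/a' subnn mulrC mulrBr.
  by rewrite [Q`_0 * _]mulrC subrr addr0.
Qed.

Lemma spec_extend x : x != 0 ->
  exists c, specialization (adjoin x c) \/ specialization (adjoin x^-1 c).
Proof.
move=> x0; have [[c Gc]|[P P1 Px]] := spec_extend_or x; first by exists c; left.
have [[c Gc]|[Q Q1 Qx]] := spec_extend_or x^-1; first by exists c; right.
by have := spec_extend_contra x0 P1 Q1 Px Qx.
Qed.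

End Extension.

(** * Limits of subspaces *)

Definition minor (R : Type) (J : Type) r (M : 'I_r -> J -> R) (f : 'I_r -> J) : 'M[R]_r :=
  \matrix_(l, m) M l (f m).

(** The identity at the columns [f] certifies independence and lets coordinates be read off as
    values at [f]; both survive specialization. *)
Definition dual_family (R : nzRingType) (J : Type) r (N : 'I_r -> J -> R) (f : 'I_r -> J) :=
  forall l m, N l (f m) = (l == m)%:R.

Section Limit.

Variables (F : fieldType) (K : closedFieldType).

(** Here [b] acts as an element of least valuation. For each new [z], the specialization is extended
    to [z / b], and [b] is kept, or to [b / z], and [z] replaces [b]. *)
Lemma spec_dominant (G : F -> K -> Prop) (a : F) (s : seq F) :
    specialization G -> a != 0 ->
  exists G' b, [/\ specialization G', forall x c, G x c -> G' x c, b \in a :: s, b != 0 &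
    forall y, y \in a :: s -> exists c, G' (y / b) c].
Proof.
move=> specG a0; elim: s => [|z s [G1 [b [specG1 sub1 b_s b0 ratio_b]]]].
  exists G, a; split=> //; first exact: mem_head.
  by move=> y; rewrite inE => /eqP->; exists 1; rewrite divff //; apply: spec1.
have b_zs : b \in [:: a, z & s].
  by move: b_s; rewrite !inE => /orP[->|->] //; rewrite !orbT.
have mem_zs y : y \in [:: a, z & s] -> y = z \/ y \in a :: s.
  by rewrite !inE => /or3P[->|/eqP->|->]; [right | left | right; rewrite orbT].
have [->|z0] := eqVneq z 0.
  exists G1, b; split=> //; first by move: b_s; rewrite !inE => /orP[->|->] //; rewrite !orbT.
  move=> y; rewrite !inE => /or3P[ya|/eqP->|ys].
  - by apply: ratio_b; rewrite inE ya.
  - by exists 0; rewrite mul0r; apply: spec0.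
  - by apply: ratio_b; rewrite inE ys orbT.
have [c [specG2|specG2]] := spec_extend specG1 (mulf_neq0 z0 (invr_neq0 b0)).
  exists (adjoin G1 (z / b) c), b; split=> // [x d Gxd|y /mem_zs[->|ys]].
  - exact/adjoin_sub/sub1.
  - by exists c; apply: adjoin_gen.
  - by have [d Gd] := ratio_b y ys; exists d; apply: adjoin_sub.
exists (adjoin G1 (z / b)^-1 c), z; split=> // [x d Gxd||y /mem_zs[->|ys]].
- exact/adjoin_sub/sub1.
- by rewrite !inE eqxx orbT.
- by exists 1; rewrite divff //; apply: spec1.
- have [d Gd] := ratio_b y ys; exists (d * c).
  have -> : y / z = (y / b) * (z / b)^-1.
    by rewrite invf_div mulrA mulfVK.
  by apply: (specM specG2); [exact: adjoin_sub | exact: adjoin_gen].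
Qed.

Variables (J : finType) (r : nat).
Implicit Types (M N : 'I_r -> J -> F).

(** Cramer's rule: once normalized by the inverse minor, the modified minor is the identity outside
    column [l], so its determinant is its diagonal entry there. *)
Lemma cramer_minor M (f : 'I_r -> J) l j : minor M f \in unitmx ->
  \sum_m invmx (minor M f) l m * M m j =
  \det (minor M (fun m => if m == l then j else f m)) / \det (minor M f).
Proof.
move=> uM; set g := invmx _; set f' := fun m => if m == l then j else f m.
have -> : \det (minor M f') / \det (minor M f) = \det (g *m minor M f').
  by rewrite det_mulmx det_inv mulrC.
have NE a : (g *m minor M f') a l = \sum_m g a m * M m j.
  by rewrite mxE; apply: eq_bigr => m _; rewrite mxE /f' eqxx.
have NE' a m : m != l -> (g *m minor M f') a m = (a == m)%:R.
  move=> ml; have <- : (g *m minor M f) a m = (a == m)%:R by rewrite mulVmx // mxE.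
  by rewrite !mxE; apply: eq_bigr => p _; rewrite !mxE /f' (negPf ml).
rewrite -NE (expand_det_row _ l) (bigD1 l) //= big1 ?addr0 => [|m ml]; last first.
  by rewrite NE' // eq_sym (negPf ml) mul0r.
rewrite /cofactor -signr_odd addnn odd_double mul1r.
suff -> : row' l (col' l (g *m minor M f')) = 1%:M by rewrite det1 mulr1.
apply/matrixP => a b; rewrite mxE.
by rewrite [LHS]mxE NE' 1?eq_sym ?neq_lift // mxE eq_sym (inj_eq lift_inj).
Qed.

(** A limit in the Grassmannian: normalize [M] at a dominant maximal minor. By Cramer's rule the
    entries of the new basis are ratios of minors to the dominant one, hence specialize. *)
Lemma spec_limit (G : F -> K -> Prop) M f0 : specialization G -> minor M f0 \in unitmx ->
  exists G' f g N Nb,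
  [/\ specialization G', forall x c, G x c -> G' x c, dual_family N f /\ dual_family Nb f,
      forall l j, N l j = \sum_m g l m * M m j /\ M l j = \sum_m M l (f m) * N m j &
      forall l j, G' (N l j) (Nb l j)].
Proof.
move=> specG uM0.
pose dets := [seq \det (minor M f) | f : {ffun 'I_r -> J}].
have dets_in f : \det (minor M f) \in dets.
  apply/mapP; exists (finfun f); first by rewrite mem_enum.
  by congr (\det _); apply/matrixP => l m; rewrite !mxE ffunE.
have d0 : \det (minor M f0) != 0 by rewrite -unitfE -unitmxE.
have [G' [b [specG' sub b_in b0 ratio]]] := spec_dominant dets specG d0.
have [f bE] : exists f, b = \det (minor M f).
  move: b_in; rewrite inE => /orP[/eqP->|/mapP[f _ ->]]; first by exists f0.
  by exists f.
have uM : minor M f \in unitmx by rewrite unitmxE unitfE -bE.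
pose g := invmx (minor M f); pose N l j := \sum_m g l m * M m j.
have dualN : dual_family N f.
  move=> l m; have <- : (g *m minor M f) l m = (l == m)%:R by rewrite mulVmx // mxE.
  by rewrite !mxE; apply: eq_bigr => p _; rewrite !mxE.
have [Nb' NbP] : exists Nb' : 'I_r * J -> K, forall lj, G' (N lj.1 lj.2) (Nb' lj).
  have [|Nb' NbP] := @fin_all_exists ('I_r * J)%type (fun=> K) (fun lj c => G' (N lj.1 lj.2) c).
    move=> [l j] /=.
    by rewrite /N cramer_minor // -bE; apply: ratio; rewrite inE dets_in orbT.
  by exists Nb'.
exists G', f, g, N, (fun l j => Nb' (l, j)); split=> // [|l j|l j].
- split=> // l m; apply: (spec_inj specG' (NbP (l, f m))); rewrite dualN.
  by case: (l == m); [exact: spec1 | exact: spec0].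
- split=> //; pose Mj := \col_m M m j.
  have : (minor M f *m (g *m Mj)) l 0 = Mj l 0 by rewrite mulmxA mulmxV // mul1mx.
  rewrite !mxE => <-; apply: eq_bigr => m _; rewrite !mxE; congr (_ * _).
  by apply: eq_bigr => p _; rewrite mxE.
- exact: (NbP (l, j)).
Qed.

(** The coefficients [c] need not specialize, but the coordinates of [a] in the basis [N] are its
    values at [f], which do. *)
Lemma spec_limit_span (G : F -> K -> Prop) M N (Nb : 'I_r -> J -> K) f
    (a : J -> F) (ab : J -> K) (c : 'I_r -> F) :
    specialization G -> dual_family N f ->
    (forall l j, M l j = \sum_m M l (f m) * N m j) ->
    (forall l j, G (N l j) (Nb l j)) -> (forall j, G (a j) (ab j)) ->
    (forall j, a j = \sum_l c l * M l j) ->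
  forall j, ab j = \sum_m ab (f m) * Nb m j.
Proof.
move=> specG dualN ME GN Ga aE j; apply: (spec_inj specG (Ga j)).
have -> : a j = \sum_m a (f m) * N m j.
  rewrite aE; under eq_bigr => l _ do rewrite ME mulr_sumr.
  rewrite exchange_big; apply: eq_bigr => m _.
  by rewrite aE mulr_suml; apply: eq_bigr => l _; rewrite mulrA.
by apply: spec_sum => // m; apply: specM.
Qed.

End Limit.

(** * The generic tensor of rank r and its specializations *)

Fixpoint teval (K : Type) (S : nzRingType) (g : K -> S) (t : tensor S) (p : tpoly K) : S :=
  match p with
  | PVar x y z => t x y z
  | PConst c => g c
  | PAdd p q => teval g t p + teval g t q
  | PMul p q => teval g t p * teval g t q
  end.

Lemma teval_morph (K : nzRingType) (S : nzRingType) (h : {rmorphism S -> K}) (g : K -> S)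
    (t : tensor S) (s : tensor K) p :
    (forall c, h (g c) = c) -> (forall x y z, h (t x y z) = s x y z) ->
  h (teval g t p) = peval p s.
Proof.
by move=> hg hs; elim: p => //= p IHp q IHq; rewrite (rmorphD, rmorphM) /= IHp IHq.
Qed.

Section Generic.

Variables (K : closedFieldType) (r : nat).

Notation vars := ('I_3 * 'I_r * idx)%type.
Notation mp := {mpoly K[#|{: vars}|]}.

Definition gvar (c : 'I_3) (l : 'I_r) (x : idx) : mp := 'X_(enum_rank (c, l, x)).

Definition gpoint (pt : 'I_3 -> 'I_r -> idx -> K) (i : 'I_#|{: vars}|) : K :=
  pt (enum_val i).1.1 (enum_val i).1.2 (enum_val i).2.

Lemma gvarE pt c l x : (gvar c l x).@[gpoint pt] = pt c l x.
Proof. by rewrite mevalXU /gpoint enum_rankK. Qed.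

Definition gtensor : tensor mp :=
  fun x y z => \sum_(l < r) gvar 0 l x * gvar 1 l y * gvar 2%:R l z.

Definition generic_spec (t : tensor K) (a : {fraction mp}) (b : K) :=
  exists p : tpoly K, a = tofrac (teval (@mpolyC _ K) gtensor p) /\ b = peval p t.

(** The point is [spec0E]: a polynomial vanishing at the generic tensor vanishes at every tensor of
    rank at most [r], hence at [t]. *)
Lemma generic_specialization t : border_rank_le t r -> specialization (generic_spec t).
Proof.
move=> t_r; split.
- by exists (PConst 1); rewrite /= mpolyC1 rmorph1.
- move=> _ _ [p [-> ->]]; exists (PMul (PConst (-1)) p).
  by rewrite /= mpolyCN mpolyC1 !mulN1r rmorphN.
- move=> _ _ _ _ [p [-> ->]] [q [-> ->]]; exists (PAdd p q).
  by rewrite /= rmorphD.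
- move=> _ _ _ _ [p [-> ->]] [q [-> ->]]; exists (PMul p q).
  by rewrite /= rmorphM.
- move=> b [p [/esym/eqP]]; rewrite tofrac_eq0 => /eqP p0 ->.
  apply: t_r => s [u [v [w sE]]].
  pose pt (c : 'I_3) := if c == 0 then u else if c == 1 then v else w.
  rewrite -(@teval_morph _ _ (meval (gpoint pt)) (@mpolyC _ K) gtensor s p).
  + by rewrite p0 rmorph0.
  + exact: mevalC.
  move=> x y z; rewrite sE raddf_sum; apply: eq_bigr => l _.
  by rewrite /= !mevalM !gvarE.
- by move=> b; exists (tofrac (mpolyC _ b)), (PConst b).
Qed.

(** The determinant is a nonzero polynomial because it takes the value 1 at one point. *)
Lemma generic_minor (J : Type) (W : 'I_r -> J -> mp) (f : 'I_r -> J) pt :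
    (forall l m, (W l (f m)).@[gpoint pt] = (l == m)%:R) ->
  minor (fun l j => tofrac (W l j)) f \in unitmx.
Proof.
move=> Wf; have -> : minor (fun l j => tofrac (W l j)) f = map_mx (@tofrac _) (minor W f).
  by apply/matrixP => l m; rewrite !mxE.
rewrite unitmxE unitfE det_map_mx tofrac_eq0; apply/eqP => d0.
have /eqP : (\det (minor W f)).@[gpoint pt] = 1.
  rewrite -(det1 K r) -det_map_mx; congr (\det _).
  by apply/matrixP => l m; rewrite 3!mxE; apply: Wf.
by rewrite d0 meval0 eq_sym oner_eq0.
Qed.

(* [N], [X] and [X'] are bases of the limits of the spans of the u_l v_l, u_l u_l v_l and
   u_l v_l v_l respectively; the first index of [X'] is one of the two v factors. *)
Lemma border_limits (t : tensor K) : (r <= 16)%N -> border_rank_le t r ->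
  exists (N : 'I_r -> idx * idx -> K) f (X X' : 'I_r -> idx * (idx * idx) -> K) h h',
  [/\ dual_family N f /\ (forall z, exists c, forall x y, t x y z = \sum_l c l * N l (x, y)),
      dual_family X h /\ dual_family X' h',
      forall l a b y, X l (a, (b, y)) = X l (b, (a, y)),
      forall l a b x, X' l (a, (x, b)) = X' l (b, (x, a)) &
      forall l a, (exists c, forall j, X l (a, j) = \sum_m c m * N m j) /\
                  (exists c, forall j, X' l (a, j) = \sum_m c m * N m j)].
Proof.
move=> r16 t_r.
have specG0 := generic_specialization t_r.
have card16 : #|{: idx * idx}| = 16 by rewrite !card_prod card_ord.
pose e (l : 'I_r) : idx * idx := enum_val (cast_ord (esym card16) (widen_ord r16 l)).
have e_inj l m : (e l == e m) = (l == m).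
  by rewrite (inj_eq enum_val_inj) (inj_eq (@cast_ord_inj _ _ _)).
have eE l m : ((e m).1 == (e l).1) && ((e m).2 == (e l).2) = (l == m).
  by rewrite [l == m]eq_sym -e_inj.
(* At this point the u_l v_l are the distinct basis elements [e l], which exist as [r] is at most
   16. All three families then have an identity minor. *)
pose pt (c : 'I_3) l x : K := (if c == 0 then x == (e l).1 else x == (e l).2)%:R.
pose W1 l (j : idx * idx) := gvar 0 l j.1 * gvar 1 l j.2.
pose W2 l (j : idx * (idx * idx)) := gvar 0 l j.1 * W1 l j.2.
pose W3 l (j : idx * (idx * idx)) := gvar 1 l j.1 * W1 l j.2.
have u1 : minor (fun l j => tofrac (W1 l j)) e \in unitmx.
  apply: (@generic_minor _ _ _ pt) => l m.
  by rewrite mevalM !gvarE /pt /= -natrM mulnb eE.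
have u2 : minor (fun l j => tofrac (W2 l j)) (fun m => ((e m).1, e m)) \in unitmx.
  apply: (@generic_minor _ _ _ pt) => l m.
  by rewrite !mevalM !gvarE /pt /= -!natrM !mulnb eE -eE; case: (_ == _); rewrite ?andbF.
have u3 : minor (fun l j => tofrac (W3 l j)) (fun m => ((e m).2, e m)) \in unitmx.
  apply: (@generic_minor _ _ _ pt) => l m.
  by rewrite !mevalM !gvarE /pt /= -!natrM !mulnb eE -eE; case: (_ == _); rewrite ?andbF.
(* Each limit may enlarge the specialization, so they are taken in succession and compared in the
   last one, [G3]. *)
have [G1 [f [g1 [N1 [N [specG1 sub1 [dualN1 dualN] N1E GN1]]]]]] := spec_limit specG0 u1.
have [G2 [h [g2 [N2 [X [specG2 sub2 [_ dualX] N2E GX]]]]]] := spec_limit specG1 u2.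
have [G3 [h' [g3 [N3 [X' [specG3 sub3 [_ dualX'] N3E GX']]]]]] := spec_limit specG2 u3.
have span a ab c : (forall j, G3 (a j) (ab j)) ->
    (forall j, a j = \sum_l c l * tofrac (W1 l j)) ->
    exists c', forall j, ab j = \sum_m c' m * N m j.
  move=> Ga aE; exists (fun m => ab (f m)).
  apply: (spec_limit_span specG3 dualN1 (fun l j => (N1E l j).2) _ Ga aE) => l j.
  exact/sub3/sub2.
exists N, f, X, X', h, h'; split=> // [|l a b y|l a b x|l a].
- split=> // z.
  have [||c cE] := span (fun j => tofrac (gtensor j.1 j.2 z)) (fun j => t j.1 j.2 z)
                        (fun l => tofrac (gvar 2%:R l z)).
  + by move=> j; apply/sub3/sub2/sub1; exists (PVar _ j.1 j.2 z).
  + by move=> j; rewrite rmorph_sum; apply: eq_bigr => l _; rewrite /W1 !rmorphM mulrC.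
  by exists c => x y; exact: (cE (x, y)).
- apply: (spec_inj specG2 (GX _ _)).
  have -> : N2 l (a, (b, y)) = N2 l (b, (a, y)); last exact: GX.
  rewrite !(N2E l _).1; apply: eq_bigr => m _; congr (_ * tofrac _).
  by rewrite /W2 /W1 /= mulrCA.
- apply: (spec_inj specG3 (GX' _ _)).
  have -> : N3 l (a, (x, b)) = N3 l (b, (x, a)); last exact: GX'.
  rewrite !(N3E l _).1; apply: eq_bigr => m _; congr (_ * tofrac _).
  by rewrite /W3 /W1 /= mulrCA [RHS]mulrCA; congr (_ * _); rewrite mulrC.
- split.
  (* The slice of u_l u_l v_l at [a] is u_l(a) times u_l v_l, so slices of the limit lie in the span
     of [N]. *)
  + apply: (span (fun j => N2 l (a, j)) _ (fun m => g2 l m * tofrac (gvar 0 m a))) => j.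
      exact/sub3/GX.
    by rewrite (N2E l _).1; apply: eq_bigr => m _; rewrite /W2 rmorphM mulrA.
  + apply: (span (fun j => N3 l (a, j)) _ (fun m => g3 l m * tofrac (gvar 1 m a))) => j.
      exact: GX'.
    by rewrite (N3E l _).1; apply: eq_bigr => m _; rewrite /W3 rmorphM mulrA.
Qed.

End Generic.

(** * Symmetric tensors with slices in a given space *)

Lemma rev_ord2_neq (j : 'I_2) : (rev_ord j == j) = false.
Proof. by case: j => [[|[|]]]. Qed.

Lemma ord2P (i j : 'I_2) : i = j \/ i = rev_ord j.
Proof.
by case: i j => [[|[|//]] ?] [[|[|//]] ?]; (left; exact: val_inj) || (right; exact: val_inj).
Qed.

Lemma sum_ord2 (V : nmodType) (j : 'I_2) (f : 'I_2 -> V) : \sum_i f i = f j + f (rev_ord j).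
Proof.
rewrite (bigD1 j) //= (bigD1 (rev_ord j)) ?rev_ord2_neq //= big1 ?addr0 // => i.
by case: (ord2P i j) => ->; rewrite eqxx ?andbF.
Qed.

Lemma sum_idx (V : nmodType) (j : 'I_2) (f : idx -> V) :
  \sum_x f x = \sum_i (f (i, j) + f (i, rev_ord j)).
Proof.
transitivity (\sum_i \sum_j f (i, j)); last by apply: eq_bigr => i _; apply: sum_ord2.
by rewrite pair_bigA; apply: eq_bigr => -[].
Qed.

Section Coordinates.

Variable K : fieldType.
Implicit Types (tau : 'I_2 -> 'I_2 -> 'I_2 -> K) (Z : idx * idx -> K).

(* [Some j] stands for the off-diagonal positions e_ij (x) e_lk with l <> j, and [None] for the
   one direction left over on the diagonal l = j modulo the slices of the tensor. *)
Definition slot := option 'I_2.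

(** With [tau] the nonzero coefficients of the tensor, these 12 linear forms cut out the span of its
    4 slices in dimension 16. *)
Definition coord tau Z (u : 'I_2 * slot * 'I_2) : K :=
  let: (i, s, k) := u in
  if s is Some j then Z ((i, j), (rev_ord j, k))
  else tau i 1 k * Z ((i, 0), (0, k)) - tau i 0 k * Z ((i, 1), (1, k)).

Lemma coord_None tau Z i (j : 'I_2) k :
  (-1) ^+ j * coord tau Z (i, None, k) =
  tau i (rev_ord j) k * Z ((i, j), (j, k)) -
  tau i j k * Z ((i, rev_ord j), (rev_ord j, k)).
Proof.
have [rev0 rev1] : rev_ord (0 : 'I_2) = 1 /\ rev_ord (1 : 'I_2) = 0.
  by split; apply: val_inj.
case: (ord2P j 0) => ->; rewrite /= ?rev0 ?rev1 ?expr0 ?expr1 ?mul1r //.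
by rewrite mulN1r opprB.
Qed.

Lemma coord_sum tau n (c : 'I_n -> K) (Z : 'I_n -> idx * idx -> K) u :
  coord tau (fun j => \sum_m c m * Z m j) u = \sum_m c m * coord tau (Z m) u.
Proof.
case: u => [[i [j|]] k] //=.
by rewrite !mulr_sumr -sumrB; apply: eq_bigr => m _; rewrite mulrBr !(mulrCA _ (c m)).
Qed.

Lemma eq_coord tau Z Z' u : Z =1 Z' -> coord tau Z u = coord tau Z' u.
Proof. by move=> ZZ; case: u => [[i [j|]] k] /=; rewrite !ZZ. Qed.

Section Symmetric.

(** The two vectors [Y rho] span a space containing the images of the [N l] modulo the slices. *)
Variables (tau : 'I_2 -> 'I_2 -> 'I_2 -> K) (N : 'I_6 -> idx * idx -> K).
Variables (L : 'I_6 -> 'I_2 -> K) (Y : 'I_2 -> 'I_2 * slot * 'I_2 -> K).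
Variables (X : 'I_6 -> idx * (idx * idx) -> K) (h : 'I_6 -> idx * (idx * idx)).
Hypothesis tau0 : forall i j k, tau i j k != 0.
Hypothesis NE : forall l u, coord tau (N l) u = \sum_rho L l rho * Y rho u.
Hypothesis dualX : dual_family X h.
Hypothesis symX : forall l a b y, X l (a, (b, y)) = X l (b, (a, y)).
Hypothesis sliceX : forall l a, exists c, forall j, X l (a, j) = \sum_m c m * N m j.

(** Off-diagonal entries vanish outright. Swapping the first two factors makes a diagonal entry
    off-diagonal, or does so for its partner in the [None] coordinate. *)
Lemma symmetric_coord0 (Z : idx * (idx * idx) -> K) :
    (forall a b y, Z (a, (b, y)) = Z (b, (a, y))) ->
    (forall a u, coord tau (fun j => Z (a, j)) u = 0) ->
  forall j, Z j = 0.
Proof.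
move=> symZ Z0 [[i' j'] [[i j] [l k]]].
have off a i1 j1 k1 : Z (a, ((i1, j1), (rev_ord j1, k1))) = 0 := Z0 a (i1, Some j1, k1).
case: (ord2P l j) => ->; last exact: off.
have offC a i1 j1 k1 : Z (a, ((i1, rev_ord j1), (j1, k1))) = 0.
  by have := off a i1 (rev_ord j1) k1; rewrite rev_ordK.
case: (ord2P j' j) => ->; last by rewrite symZ offC.
have := coord_None tau (fun y => Z ((i', j), y)) i j k; rewrite Z0 mulr0.
have -> : Z ((i', j), ((i, rev_ord j), (rev_ord j, k))) = 0 by rewrite symZ off.
rewrite mulr0 subr0 => /esym/eqP.
by rewrite mulf_eq0 (negPf (tau0 _ _ _)) => /eqP.
Qed.

(* [Gam l (a, rho)]: coordinates of the slice of [X l] at [a] modulo the slices of the tensor. *)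
Let Gam_exists : exists Gam : 'I_6 -> idx * 'I_2 -> K,
  forall l a u, coord tau (fun j => X l (a, j)) u = \sum_rho Gam l (a, rho) * Y rho u.
Proof.
have [c cE] := @fin_all_exists ('I_6 * idx)%type (fun=> 'I_6 -> K) _ (fun la => sliceX la.1 la.2).
exists (fun l arho => \sum_m c (l, arho.1) m * L m arho.2) => l a u.
rewrite (eq_coord _ _ (cE (l, a))) coord_sum.
under eq_bigr => m _ do rewrite NE mulr_sumr.
rewrite exchange_big; apply: eq_bigr => rho _ /=.
by rewrite mulr_suml; apply: eq_bigr => m _; rewrite mulrA.
Qed.

Section Gam.

Variable Gam : 'I_6 -> idx * 'I_2 -> K.
Hypothesis GamE :
  forall l a u, coord tau (fun j => X l (a, j)) u = \sum_rho Gam l (a, rho) * Y rho u.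

(** A combination of the [X l] killed by [Gam] has all coordinates 0, hence vanishes by symmetry,
    while the [X l] are independent. *)
Lemma Gam_free (lam : 'I_6 -> K) :
  (forall p, \sum_l lam l * Gam l p = 0) -> forall l, lam l = 0.
Proof.
move=> lam0 l.
have XE : \sum_m lam m * X m (h l) = lam l.
  rewrite (bigD1 l) //= dualX eqxx mulr1 big1 ?addr0 // => m ml.
  by rewrite dualX (negPf ml) mulr0.
rewrite -XE; apply: (@symmetric_coord0 (fun j => \sum_m lam m * X m j)).
  by move=> a b y; apply: eq_bigr => m _; rewrite symX.
move=> a u; rewrite (coord_sum tau lam (fun m j => X m (a, j))).
under eq_bigr => m _ do rewrite GamE mulr_sumr.
rewrite exchange_big big1 // => rho _; under eq_bigr => m _ do rewrite mulrA.
by rewrite -mulr_suml lam0 mul0r.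
Qed.

Definition Gam_orth (R : idx * 'I_2 -> K) := forall l, \sum_p Gam l p * R p = 0.

(** This is where dimension 6 enters: [Gam] is a 6 by 8 matrix of rank 6, so its columns satisfy at
    most 2 independent relations. *)
Lemma Gam_orth_dep (R : 'I_3 -> idx * 'I_2 -> K) : (forall n, Gam_orth (R n)) ->
  exists2 c : 'I_3 -> K, exists n, c n != 0 & forall p, \sum_n c n * R n p = 0.
Proof.
move=> orthR; pose A : 'M_(6, #|{: idx * 'I_2}|) := \matrix_(l, j) Gam l (enum_val j).
pose B : 'M_(3, #|{: idx * 'I_2}|) := \matrix_(n, j) R n (enum_val j).
have rankA : \rank A = 6.
  apply/eqP; rewrite -[_ == _]/(row_free A) -kermx_eq0; apply/rowV0P => v /sub_kermxP vA.
  apply/rowP => l; rewrite mxE; apply: (@Gam_free (fun l => v 0 l)) => p.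
  have := congr1 (fun M : 'rV_ _ => M 0 (enum_rank p)) vA; rewrite !mxE => vAp; rewrite -[RHS]vAp.
  by apply: eq_bigr => m _; rewrite !mxE enum_rankK.
have AB0 : A *m B^T = 0.
  apply/matrixP => l n; rewrite !mxE -[RHS](orthR n l).
  rewrite [RHS](reindex_onto (@enum_val _ _) enum_rank) /= => [|p _]; last exact: enum_rankK.
  rewrite [RHS](eq_bigl xpredT) => [|j]; last by rewrite enum_valK eqxx.
  by apply: eq_bigr => j _; rewrite !mxE.
have cardJ : #|{: idx * 'I_2}| = 8 by rewrite !card_prod card_ord.
have leB : (\rank B <= 2)%N.
  by have := mulmx0_rank_max AB0; rewrite rankA mxrank_tr [leqRHS]cardJ (leq_add2l 6 _ 2).
have : kermx B != 0 by rewrite kermx_eq0 /row_free neq_ltn (leq_ltn_trans leB).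
move=> /rowV0Pn [v /sub_kermxP vB v0].
exists (fun n => v 0 n) => [|p]; first exact/rV0Pn.
have := congr1 (fun M : 'rV_ _ => M 0 (enum_rank p)) vB; rewrite !mxE => vBp; rewrite -[RHS]vBp.
by apply: eq_bigr => n _; rewrite !mxE enum_rankK.
Qed.


Lemma Gam_orthP (e : idx -> K) (u : idx -> 'I_2 * slot * 'I_2) :
    (forall l, \sum_a e a * coord tau (fun y => X l (a, y)) (u a) = 0) ->
  Gam_orth (fun p => e p.1 * Y p.2 (u p.1)).
Proof.
move=> e0 l; rewrite -[RHS](e0 l).
transitivity (\sum_a \sum_rho Gam l (a, rho) * (e a * Y rho (u a))).
  by rewrite pair_bigA; apply: eq_bigr => -[].
apply: eq_bigr => a _; rewrite GamE mulr_sumr.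
by apply: eq_bigr => rho _; rewrite mulrCA.
Qed.

(** Both coordinates involved are the same entry of [X l], up to swapping its first two factors. *)
Lemma Gam_orth_off (j k : 'I_2) :
  Gam_orth (fun p => (if p.1.2 == j then (-1) ^+ p.1.1 else 0) * Y p.2 (rev_ord p.1.1, Some j, k)).
Proof.
apply: (@Gam_orthP (fun a => if a.2 == j then (-1) ^+ a.1 else 0)
                   (fun a => (rev_ord a.1, Some j, k))) => l.
rewrite (sum_idx j) (sum_ord2 0) /= !eqxx rev_ord2_neq !mul0r !addr0.
have -> : rev_ord (rev_ord (0 : 'I_2)) = 0 by rewrite rev_ordK.
by rewrite [X l (_, _) in X in _ + X]symX expr0 expr1 mul1r mulN1r subrr.
Qed.

(** The weights make the diagonal entries at [j] of the two [None] coordinates cancel by symmetry.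
    The remaining entries, with the first two factors swapped, are off-diagonal coordinates of the
    slices at second index [rev_ord j], and cancel there. *)
Lemma Gam_orth_on (j k : 'I_2) :
  Gam_orth (fun p => (if p.1.2 == j then (-1) ^+ j * (-1) ^+ p.1.1 * tau p.1.1 (rev_ord j) k
     else - ((-1) ^+ p.1.1 * tau (rev_ord p.1.1) (rev_ord j) k * tau p.1.1 j k)) *
    Y p.2 (rev_ord p.1.1, if p.1.2 == j then None else Some j, k)).
Proof.
apply: (@Gam_orthP
  (fun a => if a.2 == j then (-1) ^+ j * (-1) ^+ a.1 * tau a.1 (rev_ord j) k
    else - ((-1) ^+ a.1 * tau (rev_ord a.1) (rev_ord j) k * tau a.1 j k))
  (fun a => (rev_ord a.1, if a.2 == j then None else Some j, k))) => l.
rewrite (sum_idx j) (sum_ord2 0).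
have onE i := coord_None tau (fun y => X l ((i, j), y)) (rev_ord i) j k.
have EA i c c' : (-1) ^+ j * c * c' * coord tau (fun y => X l ((i, j), y)) (rev_ord i, None, k)
   = c * c' * ((-1) ^+ j * coord tau (fun y => X l ((i, j), y)) (rev_ord i, None, k)) by ring.
cbn [fst snd]; rewrite !eqxx rev_ord2_neq !EA !onE /=.
have -> : rev_ord (rev_ord (0 : 'I_2)) = 0 by rewrite rev_ordK.
rewrite (symX l (rev_ord 0, j) (0, j)).
rewrite (symX l (rev_ord 0, j) (0, rev_ord j)) (symX l (0, j) (rev_ord 0, rev_ord j)).
rewrite expr0 expr1; ring.
Qed.

(* Comparing the entries of a symmetric [X l] gives linear relations between the columns of
   [Gam]: for each [j] and slot, one whose entries at the second index [rev_ord j] are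
   nonzero multiples of the coordinates in that slot. *)
Lemma Gam_orth_row (j : 'I_2) (s : slot) (k : 'I_2) : exists R (d : 'I_2 -> K),
  [/\ Gam_orth R, forall i, d i != 0 &
      forall i rho, R ((i, rev_ord j), rho) = d i * Y rho (rev_ord i, s, k)].
Proof.
case: s => [j'|]; first case: (ord2P j' j) => ->.
- do 2!eexists; split; first exact: (Gam_orth_on j k); last first.
    by move=> i rho /=; rewrite rev_ord2_neq.
  by move=> i /=; rewrite oppr_eq0 !mulf_neq0 ?signr_eq0.
- do 2!eexists; split; first exact: (Gam_orth_off (rev_ord j) k); last first.
    by move=> i rho /=; rewrite eqxx.
  by move=> i /=; rewrite signr_eq0.
- do 2!eexists; split; first exact: (Gam_orth_on (rev_ord j) k); last first.
    by move=> i rho /=; rewrite eqxx.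
  by move=> i /=; rewrite !mulf_neq0 ?signr_eq0.
Qed.

(** Three relations are dependent: [R1] and those of [Gam_orth_row] for the slots [s0] and [s]. At
    second index [rev_ord j] the first drops out, leaving a proportionality. *)
Lemma proportional_from (j : 'I_2) R1 s0 k0 i0 rho0 :
    Gam_orth R1 -> (forall i rho, R1 ((i, rev_ord j), rho) = 0) ->
    (exists i rho, R1 ((i, j), rho) != 0) -> Y rho0 (i0, s0, k0) != 0 ->
  forall s k, exists d : 'I_2 -> K, (forall i i', d i = 0 -> d i' = 0) /\
    forall i rho, Y rho (i, s, k) = d i * Y rho (i, s0, k0).
Proof.
move=> oR1 R10 [i1 [rho1 R1n0]] Y0 s k.
have [R2 [d2 [oR2 d20 R2E]]] := Gam_orth_row j s0 k0.
have [R3 [d3 [oR3 d30 R3E]]] := Gam_orth_row j s k.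
have [|c [n cn0] dep] := @Gam_orth_dep (fun n => if n == 0 then R1 else if n == 1 then R2 else R3).
  by move=> m; do 2?[case: ifP => _].
have {}dep p : c 0 * R1 p + c 1 * R2 p + c 2%:R * R3 p = 0.
  rewrite -[RHS](dep p) !big_ord_recl big_ord0 addr0 addrA.
  by congr (_ * _ + _ * _ + _ * _); congr c; apply: val_inj.
have dep' i rho : c 1 * (d2 i * Y rho (rev_ord i, s0, k0)) +
                  c 2%:R * (d3 i * Y rho (rev_ord i, s, k)) = 0.
  by have := dep ((i, rev_ord j), rho); rewrite R10 mulr0 add0r R2E R3E.
have c2 : c 2%:R != 0.
  apply/eqP => c2; have c1 : c 1 = 0.
    have := dep' (rev_ord i0) rho0; rewrite c2 mul0r addr0 rev_ordK => /eqP.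
    by rewrite !mulf_eq0 (negPf Y0) (negPf (d20 _)) !orbF => /eqP.
  have c0 : c 0 = 0.
    have := dep ((i1, j), rho1); rewrite c1 c2 !mul0r !addr0 => /eqP.
    by rewrite mulf_eq0 (negPf R1n0) orbF => /eqP.
  case/eqP: cn0; case: n => [[|[|[|//]]] ?]; [rewrite -c0|rewrite -c1|rewrite -c2];
  by congr c; apply: val_inj.
(* The factor [c 1 / c 2] is common to both [i] and the other is nonzero, so [d] vanishes for both
   [i] or neither. *)
exists (fun i => - (c 1 / c 2%:R) * (d2 (rev_ord i) / d3 (rev_ord i))); split.
  move=> i i' /eqP; rewrite !mulf_eq0 invr_eq0 (negPf (d20 _)) (negPf (d30 _)) !orbF.
  by rewrite oppr_eq0 => /eqP ->; rewrite oppr0 mul0r.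
move=> i rho; have := dep' (rev_ord i) rho; rewrite rev_ordK => /eqP.
rewrite addr_eq0 => /eqP E.
apply: (mulfI (d30 (rev_ord i))); apply: (mulfI c2).
rewrite -[LHS]opprK -E; field; rewrite c2 d30 //.
Qed.

(** Coordinate form of the plane being essentially U (x) s (x) w. The relation [R1] is
    [Gam_orth_off] if some off-diagonal coordinate is nonzero; otherwise it is [Gam_orth_on], whose
    off-diagonal part then vanishes. *)
Lemma proportional_Gam : exists z : 'I_2 -> 'I_2 -> K, forall s k, exists d : 'I_2 -> K,
  (forall i i', d i = 0 -> d i' = 0) /\ forall i rho, Y rho (i, s, k) = d i * z i rho.
Proof.
have [[[[j k] i] [rho Y0]]|off0] :=
    classic (exists q : 'I_2 * 'I_2 * 'I_2, exists rho, Y rho (q.2, Some q.1.1, q.1.2) != 0).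
  exists (fun i rho => Y rho (i, Some j, k)).
  apply: (@proportional_from j _ _ _ _ _ (Gam_orth_off j k) _ _ Y0) => [i' rho' /=|].
    by rewrite rev_ord2_neq mul0r.
  by exists (rev_ord i), rho; rewrite /= eqxx rev_ordK mulf_neq0 ?signr_eq0.
have {}off0 rho i j k : Y rho (i, Some j, k) = 0.
  by apply/eqP/negPn/negP => Y0; apply: off0; exists (j, k, i), rho.
have [[[k i] [rho Y0]]|on0] :=
    classic (exists q : 'I_2 * 'I_2, exists rho, Y rho (q.2, None, q.1) != 0).
  exists (fun i rho => Y rho (i, None, k)).
  apply: (@proportional_from 0 _ _ _ _ _ (Gam_orth_on 0 k) _ _ Y0) => [i' rho' /=|].
    by rewrite ?rev_ord2_neq off0 mulr0.
  by exists (rev_ord i), rho; rewrite /= rev_ordK !mulf_neq0 ?signr_eq0.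
exists (fun _ _ => 0) => s k; exists (fun=> 0); split=> // i rho; rewrite mul0r.
case: s => [j|]; first exact: off0.
by apply/eqP/negPn/negP => Y0; apply: on0; exists (k, i), rho.
Qed.

End Gam.

Lemma proportional : exists z : 'I_2 -> 'I_2 -> K, forall s k, exists d : 'I_2 -> K,
  (forall i i', d i = 0 -> d i' = 0) /\ forall i rho, Y rho (i, s, k) = d i * z i rho.
Proof. by have [Gam GamE] := Gam_exists; apply: proportional_Gam GamE. Qed.

End Symmetric.

(** * The quotient by the slices of the tensor *)

Section Quotient.

Variables (t : tensor K) (N : 'I_6 -> idx * idx -> K) (f : 'I_6 -> idx * idx).
Hypothesis supp_t : same_support t (mamu K).
Hypothesis dualN : dual_family N f.
Hypothesis tN : forall z, exists c, forall x y, t x y z = \sum_l c l * N l (x, y).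

Let tau i j k := t (i, j) (j, k) (k, i).

Lemma tau_neq0 i j k : tau i j k != 0.
Proof. by rewrite /tau supp_t /mamu /= !eqxx oner_eq0. Qed.

Lemma supp_eq0 x y z : ~~ [&& x.2 == y.1, y.2 == z.1 & z.2 == x.1] -> t x y z = 0.
Proof.
move=> /negPf xyz; apply/eqP/negPn; rewrite supp_t /mamu xyz.
by rewrite eqxx.
Qed.

Lemma coord_slice z u : coord tau (fun xy => t xy.1 xy.2 z) u = 0.
Proof.
case: u => [[i [j|]] k] /=; first by rewrite supp_eq0 //= eq_sym rev_ord2_neq.
have [->|zki] := eqVneq z (k, i); first by rewrite /tau mulrC subrr.
have z0 j : t (i, j) (j, k) z = 0.
  rewrite supp_eq0 //= eqxx /=; apply: contra zki.
  by case: z => z1 z2 /= /andP[/eqP-> /eqP->].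
by rewrite !z0 !mulr0 subrr.
Qed.

(** Slice (k, i) is supported on e_ij (x) e_jk, j = 0, 1: its coefficient is read off at j = 0, and
    the [None] coordinate gives agreement at j = 1. *)
Lemma coord0_slices Z : (forall u, coord tau Z u = 0) ->
  forall xy, Z xy = \sum_z Z ((z.2, 0), (0, z.1)) / tau z.2 0 z.1 * t xy.1 xy.2 z.
Proof.
move=> Z0 [[i j] [l k]].
case: (ord2P l j) => ->; last first.
  have -> : Z ((i, j), (rev_ord j, k)) = 0 := Z0 (i, Some j, k).
  rewrite big1 // => z _.
  by rewrite supp_eq0 ?mulr0 //= eq_sym rev_ord2_neq.
rewrite (bigD1 (k, i)) //= big1 ?addr0 => [|z zki]; last first.
  rewrite supp_eq0 ?mulr0 //= eqxx /=; apply: contra zki.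
  by case: z => z1 z2 /= /andP[/eqP-> /eqP->].
case: (ord2P j 0) => ->; first by rewrite mulfVK // tau_neq0.
have -> : rev_ord (0 : 'I_2) = 1 by apply: val_inj.
have /eqP := Z0 (i, None, k); rewrite /= subr_eq0 => /eqP E.
apply: (mulfI (tau_neq0 i 0 k)); rewrite -E -/(tau i 1 k); field.
exact: tau_neq0.
Qed.

(** On the 6-dimensional span of [N], the kernel of the coordinates is the 4-dimensional span of the
    slices. The coordinate matrix thus has rank 2, and [L], [Y] are a rank factorization. *)
Lemma quotient_coords : exists (L : 'I_6 -> 'I_2 -> K) Y,
  (forall l u, coord tau (N l) u = \sum_rho L l rho * Y rho u) /\
  (forall c : 'I_2 -> K, (forall u, \sum_rho c rho * Y rho u = 0) -> forall rho, c rho = 0).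
Proof.
have [c cE] := @fin_all_exists idx (fun=> 'I_6 -> K) _ tN.
pose C : 'M_(#|{: idx}|, 6) := \matrix_(z, l) c (enum_val z) l.
pose B : 'M_(6, #|{: 'I_2 * slot * 'I_2}|) := \matrix_(l, u) coord tau (N l) (enum_val u).
have CB0 : C *m B = 0.
  apply/matrixP => z u; rewrite !mxE -[RHS](coord_slice (enum_val z) (enum_val u)).
  rewrite (eq_coord _ _ (fun xy => cE (enum_val z) xy.1 xy.2)).
  rewrite (eq_coord _ _ (Z' := fun xy => \sum_l c (enum_val z) l * N l xy)); last by case.
  by rewrite coord_sum; apply: eq_bigr => l _; rewrite !mxE.
have kerC : (kermx B <= C)%MS.
  apply/rV_subP => v /sub_kermxP vB; apply/submxP.
  pose Z xy := \sum_l v 0 l * N l xy.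
  have Z0 u : coord tau Z u = 0.
    have := congr1 (fun M : 'rV_ _ => M 0 (enum_rank u)) vB; rewrite !mxE => vBu.
    rewrite /Z coord_sum -[RHS]vBu; apply: eq_bigr => l _.
    by rewrite !mxE enum_rankK.
  have ZE := coord0_slices Z0.
  exists (\row_z (let: (k, i) := enum_val z in Z ((i, 0), (0, k)) / tau i 0 k)).
  apply/rowP => l; rewrite !mxE.
  have ZfE : Z (f l) = v 0 l.
    rewrite /Z (bigD1 l) //= dualN eqxx mulr1 big1 ?addr0 // => m ml.
    by rewrite dualN (negPf ml) mulr0.
  rewrite -ZfE ZE (reindex_onto (@enum_val _ _) enum_rank) /= => [|z _]; last exact: enum_rankK.
  rewrite (eq_bigl xpredT) => [|z]; last by rewrite enum_valK eqxx.
  apply: eq_bigr => z _; rewrite !mxE; congr (_ * _); first by case: (enum_val z).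
  rewrite cE -surjective_pairing (bigD1 l) //= dualN eqxx mulr1 big1 ?addr0 // => m ml.
  by rewrite dualN (negPf ml) mulr0.
(* Only slice (k, i) is nonzero at e_i0 (x) e_0k. *)
have freeC : row_free C.
  rewrite -kermx_eq0; apply/rowV0P => v /sub_kermxP vC.
  apply/rowP => z; rewrite mxE -[z]enum_valK; case: (enum_val z) => k i.
  have : \sum_z v 0 z * t (i, 0) (0, k) (enum_val z) = 0.
    under eq_bigr => w _ do rewrite cE mulr_sumr.
    rewrite exchange_big big1 // => l _.
    have := congr1 (fun M : 'rV_ _ => M 0 l) vC; rewrite !mxE => vCl.
    rewrite -[RHS](mul0r (N l ((i, 0), (0, k)))) -[X in _ = X * _]vCl mulr_suml.
    by apply: eq_bigr => w _; rewrite !mxE mulrA.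
  rewrite (bigD1 (enum_rank (k, i))) //= enum_rankK big1 ?addr0 => [/eqP|w wki].
    by rewrite mulf_eq0 (negPf (tau_neq0 i 0 k)) orbF => /eqP.
  rewrite supp_eq0 ?mulr0 //= ?eqxx /=; apply: contra wki => /andP[/eqP e1 /eqP e2].
  by rewrite -[w]enum_valK [enum_val w]surjective_pairing -e1 e2.
have rankB : \rank B = 2.
  have rkC : \rank C = 4 by move/eqP: freeC => ->; rewrite card_prod !card_ord.
  have : \rank (kermx B) = 4.
    rewrite -rkC; apply/eqP; rewrite eqn_leq mxrankS //= mxrankS //.
    exact/sub_kermxP.
  by rewrite mxrank_ker; have := rank_leq_row B; lia.
have := mulmx_base B; have := row_base_free B.
move: (col_base B) (row_base B); rewrite rankB => L Y freeY LY.
exists (fun l rho => L l rho), (fun rho u => Y rho (enum_rank u)); split=> [l u|a a0 rho].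
  have := congr1 (fun M : 'M_(6, _) => M l (enum_rank u)) LY.
  by rewrite !mxE enum_rankK => <-.
have aY : (\row_m a m) *m Y = 0.
  apply/rowP => u; rewrite !mxE -[RHS](a0 (enum_val u)).
  by apply: eq_bigr => m _; rewrite mxE enum_valK.
have /rowP/(_ rho) : \row_m a m = 0 by apply: (row_free_inj freeY); rewrite mul0mx.
by rewrite !mxE.
Qed.

End Quotient.

(** * Incompatibility of the two symmetric spaces *)

Definition tr (x : idx) : idx := (x.2, x.1).

(* The second symmetric space is reduced to the first by the symmetry
   x (x) y -> y^T (x) x^T of the matrix multiplication support. *)
Lemma no_apolar_space (t : tensor K) (N : 'I_6 -> idx * idx -> K) f
    (X X' : 'I_6 -> idx * (idx * idx) -> K) h h' :
    same_support t (mamu K) -> dual_family N f ->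
    (forall z, exists c, forall x y, t x y z = \sum_l c l * N l (x, y)) ->
    dual_family X h -> dual_family X' h' ->
    (forall l a b y, X l (a, (b, y)) = X l (b, (a, y))) ->
    (forall l a b x, X' l (a, (x, b)) = X' l (b, (x, a))) ->
    (forall l a, exists c, forall j, X l (a, j) = \sum_m c m * N m j) ->
    (forall l a, exists c, forall j, X' l (a, j) = \sum_m c m * N m j) ->
  False.
Proof.
move=> supp_t dualN tN dualX dualX' symX symX' sliceX sliceX'.
have [L [Y [NE Y_free]]] := quotient_coords supp_t dualN tN.
have tau0 := tau_neq0 supp_t.
have [z zP] := proportional tau0 NE dualX symX sliceX.
(* Transposition turns e_ij (x) e_lk into e_kl (x) e_ji, and [l] is [rev_ord j] off the diagonal. *)
pose swap_slot (s : slot) : slot := if s is Some j then Some (rev_ord j) else None.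
pose N' l (xy : idx * idx) := N l (tr xy.2, tr xy.1).
pose Y' rho (u : 'I_2 * slot * 'I_2) := Y rho (u.2, swap_slot u.1.2, u.1.1).
pose tau' i j k := t (k, j) (j, i) (i, k).
pose X'' l (j : idx * (idx * idx)) := X' l (tr j.1, (tr j.2.2, tr j.2.1)).
pose h'' l : idx * (idx * idx) := (tr (h' l).1, (tr (h' l).2.2, tr (h' l).2.1)).
have NE' l u : coord tau' (N' l) u = \sum_rho L l rho * Y' rho u.
  rewrite /Y' -NE; case: u => [[i [j|]] k] //=.
  by rewrite rev_ordK.
have [||||w wP] := @proportional tau' N' L Y' X'' h'' _ NE'.
- by move=> i j k; apply: tau0.
- move=> l m; rewrite -dualX' /X'' /h'' /tr /=.
  by case: (h' m) => [[? ?] [[? ?] [? ?]]].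
- by move=> l a b y; rewrite /X'' /= symX'.
- by move=> l a; have [c cE] := sliceX' l (tr a); exists c => j; rewrite /X'' cE.
have [u [rho Yu]] : exists u, exists rho, Y rho u != 0.
  apply: NNPP => Y0; suff /eqP : (1 : K) = 0 by rewrite oner_eq0.
  apply: (Y_free (fun=> 1) _ 0) => u.
  rewrite big1 // => rho _; rewrite mul1r; apply/eqP/negPn/negP => Yu.
  by apply: Y0; exists u, rho.
case: u Yu => [[i s] k] Yu.
have [d [d0 dE]] := zP s k.
(* At the slot of a nonzero entry of [Y] both [d i'] are nonzero, so both [z i'] are multiples of
   [w k], and then so is all of [Y]. *)
have zE i' : exists e, forall rho', z i' rho' = e * w k rho'.
  have di0 : d i' != 0.
    by apply: contraNneq Yu => /(d0 i' i) di; rewrite dE di mul0r.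
  have [e [_ eE]] := wP (swap_slot s) i'; exists (e k / d i') => rho'.
  apply: (mulfI di0); rewrite -dE mulrA mulrCA divff // mulr1 -eE /Y' /=.
  by case: (s) => //= j; rewrite rev_ordK.
have YE v : exists e, forall rho', Y rho' v = e * w k rho'.
  case: v => [[i' s'] k']; have [e eE] := zE i'; have [d1 [_ d1E]] := zP s' k'.
  by exists (d1 i' * e) => rho'; rewrite d1E eE mulrA.
(* The vector orthogonal to [w k] annihilates [Y], so it vanishes by independence of the two rows of
   [Y]. *)
have w0 : forall rho' : 'I_2, (if rho' == 0 then w k 1 else - w k 0) = 0.
  apply: (Y_free (fun rho' => if rho' == 0 then w k 1 else - w k 0)) => v; have [e eE] := YE v.
  rewrite !big_ord_recl big_ord0 addr0 !eE /=.
  have -> : lift ord0 ord0 = 1 :> 'I_2 by apply: val_inj.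
  ring.
have [e eE] := YE (i, s, k); move: Yu; rewrite eE.
have -> : w k rho = 0; last by rewrite mulr0 eqxx.
have /eqP := w0 1; rewrite /= oppr_eq0 => /eqP wk0; have /= wk1 := w0 0.
by case: rho => [[|[|//]] ?]; [rewrite -wk0 | rewrite -wk1]; congr (w k _); apply: val_inj.
Qed.

End Coordinates.

(** * Upper bound and conclusion *)

Lemma strassen (K : nzRingType) : rank_le (mamu K) 7.
Proof.
pose coef (s : seq (seq K)) (l : 'I_7) (x : idx) : K := (nth [::] s l)`_(2 * x.1 + x.2)%N.
exists (coef [:: [:: 1; 0; 0; 1]; [:: 0; 0; 1; 1]; [:: 1; 0; 0; 0]; [:: 0; 0; 0; 1];
                 [:: 1; 1; 0; 0]; [:: -1; 0; 1; 0]; [:: 0; 1; 0; -1]]).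
exists (coef [:: [:: 1; 0; 0; 1]; [:: 1; 0; 0; 0]; [:: 0; 1; 0; -1]; [:: -1; 0; 1; 0];
                 [:: 0; 0; 0; 1]; [:: 1; 1; 0; 0]; [:: 0; 0; 1; 1]]).
(* The contributions of Strassen's products to the result, transposed since the third factor of the
   tensor is e_ki. *)
exists (coef [:: [:: 1; 0; 0; 1]; [:: 0; 1; 0; -1]; [:: 0; 0; 1; 1]; [:: 1; 1; 0; 0];
                 [:: -1; 0; 1; 0]; [:: 0; 0; 0; 1]; [:: 1; 0; 0; 0]]).
move=> [[[|[|//]] ?] [[|[|//]] ?]] [[[|[|//]] ?] [[|[|//]] ?]] [[[|[|//]] ?] [[|[|//]] ?]].
all: rewrite !big_ord_recl big_ord0 /coef /mamu /=.
all: by rewrite ?(mul0r, mulr0, mul1r, mulr1, mulNr, mulrN, add0r, addr0, oppr0, opprK,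
                  subrr, addrK, subrK, addNr).
Qed.

Lemma rank_le_border (K : nzRingType) (t : tensor K) r : rank_le t r -> border_rank_le t r.
Proof. by move=> t_r p; apply. Qed.

(* Border support rank of <2,2,2> is 7, over any algebraically closed
   field of characteristic 0 (in particular over C). *)
Theorem theorem2 (K : closedFieldType) (charK : [pchar K] =i pred0) :
  (forall t : tensor K, same_support t (mamu K) -> ~ border_rank_le t 6) /\
  (exists t : tensor K, same_support t (mamu K) /\
     border_rank_le t 7 /\ ~ border_rank_le t 6).
Proof.
have lower (t : tensor K) : same_support t (mamu K) -> ~ border_rank_le t 6.
  move=> supp_t /(border_limits (isT : (6 <= 16)%N)).
  move=> [N [f [X [X' [h [h' [[dualN tN] [dualX dualX'] symX symX' sliceX]]]]]]].
  apply: (no_apolar_space supp_t dualN tN dualX dualX' symX symX') => l a.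
    by case: (sliceX l a).
  by case: (sliceX l a).
split=> //; exists (mamu K); split=> //; split; last exact: lower.
exact/rank_le_border/strassen.
Qed.
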